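(* For each $n\in\mathbb{N}$ and each $f\in\mathcal{S}(H_n)$, where $H_n$ is Cook's continuum, the system $(H_n,f)$ has the continuously generated pseudo-orbit tracing property (CGPOTP) but does not have shadowing.
   Context: A continuum is a compact connected metric space; $\mathbb{N}$ is the set of positive integers and $\omega$ the non-negative integers. For a compact metric space $(X,d)$, $\mathcal{C}(X)$ is the space of continuous maps $f:X\to X$ with the supremum metric $\rho(f,g)=\sup_{x\in X}d(f(x),g(x))$, and $\mathcal{S}(X)\subseteq\mathcal{C}(X)$ is the subspace of surjections. For $\delta>0$, a $\delta$-pseudo-orbit for $f\in\mathcal{C}(X)$ is a sequence $\langle x_i\rangle_{i\in\omega}$ in $X$ with $d(f(x_i),x_{i+1})<\delta$ for all $i\in\omega$. $(X,f)$ has shadowing if for every $\epsilon>0$ there is $\delta>0$ such that for every $\delta$-pseudo-orbit $\langle x_i\rangle$ for $f$ there is $z\in X$ with $d(x_i,f^i(z))<\epsilon$ for all $i\in\omega$. $(X,f)$ has CGPOTP if for every $\epsilon>0$ there is $\delta>0$ such that whenever $g\in\mathcal{C}(X)$ satisfies $\rho(f,g)<\delta$, every $g$-orbit is $\epsilon$-shadowed by an $f$-orbit, i.e. for every $x\in X$ there is $z\in X$ with $d(g^i(x),f^i(z))<\epsilon$ for all $i\in\omega$. Cook's continua (a known result of Cook, which may be assumed): for each $n\in\mathbb{N}$ there exists a non-degenerate continuum $H_n$ (i.e. with more than one point) such that $\mathcal{S}(H_n)$ has exactly $n$ elements, each of which is a homeomorphism, and every $f\in\mathcal{C}(H_n)\setminus\mathcal{S}(H_n)$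 is constant (i.e. $f(H_n)$ is a singleton). $H_n$ denotes such a continuum. *)

(* Defs.v *)
From mathcomp Require Import all_boot all_order all_algebra.
From mathcomp Require Import all_classical all_reals all_analysis.

Set Implicit Arguments.
Unset Strict Implicit.
Unset Printing Implicit Defensive.

Import Order.TTheory GRing.Theory Num.Theory.

Local Open Scope classical_set_scope.
Local Open Scope card_scope.
Local Open Scope ring_scope.

Definition cmaps (X : topologicalType) : set (X -> X) :=
  [set f | continuous f].

Definition csurjs (X : topologicalType) : set (X -> X) :=
  [set f | cmaps f /\ set_surj [set: X] [set: X] f].

Definition homeomorphism (X Y : topologicalType) (f : X -> Y) : Prop :=
  continuous f /\ exists g : Y -> X, [/\ continuous g, cancel f g & cancel g f].

(* [sup] is a junk value on unbounded sets; on a nonempty compact space, the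
   distances between two continuous maps form a bounded nonempty set. *)
Definition sup_dist (R : realType) (X : metricType R) (f g : X -> X) : R :=
  sup [set mdist (f x) (g x) | x in [set: X]].

Definition pseudo_orbit (R : realType) (X : metricType R) (f : X -> X)
    (delta : R) (u : nat -> X) : Prop :=
  forall i, mdist (f (u i)) (u i.+1) < delta.

Definition shadowed_by (R : realType) (X : metricType R) (f : X -> X)
    (eps : R) (u : nat -> X) (z : X) : Prop :=
  forall i, mdist (u i) (iter i f z) < eps.

Definition shadowing (R : realType) (X : metricType R) (f : X -> X) : Prop :=
  forall eps : R, 0 < eps -> exists2 delta : R, 0 < delta &
    forall u : nat -> X, pseudo_orbit f delta u ->
      exists z : X, shadowed_by f eps u z.

Definition CGPOTP (R : realType) (X : metricType R) (f : X -> X) : Prop :=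
  forall eps : R, 0 < eps -> exists2 delta : R, 0 < delta &
    forall g : X -> X, cmaps g -> sup_dist f g < delta ->
      forall x : X, exists z : X, shadowed_by f eps (fun i => iter i g x) z.

Definition continuum (R : realType) (X : metricType R) : Prop :=
  compact [set: X] /\ connected [set: X].

Record cook_continuum (R : realType) (n : nat) (X : metricType R) : Prop :=
  CookContinuum {
    cook_is_continuum : continuum X ;
    cook_nondegenerate : exists x y : X, x <> y ;
    cook_card_csurjs : csurjs (X := X) #= `I_n ;
    cook_csurj_homeo : forall f : X -> X, csurjs f -> homeomorphism f ;
    cook_nonsurj_constant : forall f : X -> X, (cmaps (X := X) `\` csurjs (X := X)) f ->
      exists c : X, f @` [set: X] = [set c]
  }.

(* Main.v *)
Require Import Defs.
From mathcomp Require Import all_boot all_order all_algebra finmap.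
From mathcomp Require Import all_classical all_reals all_analysis.

(** Cook's hypotheses make [H] rigid, and both halves of the theorem are
    consequences of this rigidity.

    CGPOTP holds because [f] is an isolated point of the space of continuous
    self-maps of [H].  The other surjections are finitely many, so they stay
    at a positive distance from [f]; and a constant map is at distance at least
    half of the diameter of [H] from the surjection [f] ([const_far_from_surj]).
    Hence a continuous [g] close enough to [f] is [f] itself
    ([cook_surj_isolated]), and every [g]-orbit is an [f]-orbit.

    Shadowing fails because [f] is periodic: its iterates are surjections and
    there are only finitely many of these, so two of them agree, and [f] is
    injective ([injective_finite_iter_periodic]).  If [f] has period [m], all
    [f]-orbits repeat after [m] steps.  A pseudo-orbit, by contrast, can run
    once around the orbit of a point [p], land on [p] up to a small error, and
    use that error to continue around the orbit of a neighbour of [p].  A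
    connected space is chained by arbitrarily small steps
    ([connected_chainable]), so pseudo-orbits of arbitrarily small error drift
    between any two given points, and no periodic orbit stays near them
    ([periodic_not_shadowing]). *)

Set Implicit Arguments.
Unset Strict Implicit.
Unset Printing Implicit Defensive.

Import Order.TTheory GRing.Theory Num.Theory.
Import metricType_numDomainType.

Local Open Scope classical_set_scope.
Local Open Scope card_scope.
Local Open Scope ring_scope.

(** The balls of growing radius around a point [a] form an increasing cover, so
    by compactness one of them is the whole space. *)
Lemma compact_mdist_bounded (R : realType) (X : metricType R) :
  compact [set: X] ->
  exists M : R, forall x y : X, mdist x y <= M.
Proof.
move=> /compact_near_coveringP cX.
have [[a]|X0] := pselect (inhabited X); last first.
  by exists 0 => x; case: X0; exists.
have : \forall M \near +oo, [set: X] `<=` [set x | mdist a x < M].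
  apply: (cX R (+oo)%R (fun M x => mdist a x < M)) => x _.
  exists (ball x 1, [set M | mdist a x + 1 < M]) => [|[y M] [/=]].
    split=> /=; first exact: nbhsx_ballx.
    by apply: nbhs_pinfty_gt; rewrite num_real.
  rewrite ballEmdist/= => xy; apply: le_lt_trans.
  by rewrite (le_trans (metric_triangle _ x _))// lerD2l ltW.
move=> /(@filter_ex _ _ _)[M aM]; exists (M + M) => x y.
rewrite (le_trans (metric_triangle _ a _))//.
by rewrite lerD// ?[mdist x a]metric_sym ltW// aM.
Qed.

(** Compactness is what makes the supremum defining [sup_dist] a genuine one. *)
Lemma mdist_le_sup_dist (R : realType) (X : metricType R) (f g : X -> X) (x : X) :
  compact [set: X] -> mdist (f x) (g x) <= sup_dist f g.
Proof.
move=> /compact_mdist_bounded[M XM]; apply: ub_le_sup; last by exists x.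
by exists M => _ [y _ <-].
Qed.

Lemma sup_dist_gt0 (R : realType) (X : metricType R) (f g : X -> X) :
  compact [set: X] -> g <> f -> 0 < sup_dist f g.
Proof.
move=> cX gf; have /existsNP[x /eqP fgx] : ~ forall x, f x = g x.
  by move=> fg; apply: gf; apply/funext => x; rewrite fg.
by apply: lt_le_trans (mdist_le_sup_dist f g x cX); rewrite mdist_gt0.
Qed.

Lemma finite_sup_dist_isolated (R : realType) (X : metricType R) (f : X -> X)
    (A : set (X -> X)) :
  compact [set: X] -> finite_set A ->
  \forall d \near 0^'+, forall g, A g -> sup_dist f g < d -> g = f.
Proof.
move=> cX finA.
have /finite_fsetP[E EE] : finite_set [set sup_dist f g | g in A `\ f].
  by apply: finite_image; apply: sub_finite_set finA => g [].
have : \forall d \near 0^'+, (\bigcap_(e in [set` E]) [set d : R | d < e]) d.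
  apply: filter_bigI => e eE; apply: nbhs_right_lt.
  have : [set` E] e by [].
  by rewrite -EE => -[g [_ gf] <-]; apply: sup_dist_gt0.
apply: filterS => d dE g Ag; apply: contraPP => gf.
have /dE /= dg : [set` E] (sup_dist f g) by rewrite -EE; exists g.
by move/(lt_trans dg); rewrite ltxx.
Qed.

(** A constant map lies within [sup_dist f g] of both of the values [a] and [b]
    of the surjection [f], so the triangle inequality applies. *)
Lemma const_far_from_surj (R : realType) (X : metricType R) (f g : X -> X)
    (a b c : X) :
  compact [set: X] -> set_surj [set: X] [set: X] f ->
  g @` [set: X] = [set c] -> mdist a b / 2 <= sup_dist f g.
Proof.
move=> cX sf gc.
have fc y : mdist y c <= sup_dist f g.
  have [x _ <-] := sf y I.
  have <- : g x = c by have : [set c] (g x) by rewrite -gc; exists x.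
  exact: mdist_le_sup_dist.
rewrite ler_pdivrMr// mulr_natr mulr2n.
by rewrite (le_trans (metric_triangle _ c _))// lerD// metric_sym.
Qed.

Lemma cook_finite_csurjs (R : realType) (n : nat) (H : metricType R) :
  cook_continuum n H -> finite_set (csurjs (X := H)).
Proof. by move=> [_ _ /eq_finite_set -> _ _]; exact: finite_II. Qed.

Lemma cook_surj_isolated (R : realType) (n : nat) (H : metricType R)
    (f : H -> H) :
  cook_continuum n H -> csurjs f ->
  exists2 d : R, 0 < d & forall g, cmaps g -> sup_dist f g < d -> g = f.
Proof.
move=> hH [_ sf]; have [cH _] := cook_is_continuum hH.
have [a [b /eqP ab]] := cook_nondegenerate hH.
near (0 : R)^'+ => d; exists d => // g cg fgd.
have [sg|nsg] := pselect (csurjs g).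
  move: g sg {cg} fgd; near: d.
  exact: finite_sup_dist_isolated (cook_finite_csurjs hH).
have [c gc] := cook_nonsurj_constant hH (conj cg nsg).
have := le_lt_trans (const_far_from_surj a b cH sf gc) fgd.
suff /lt_trans/[apply] : d < mdist a b / 2 by rewrite ltxx.
by near: d; apply: nbhs_right_lt; rewrite divr_gt0// mdist_gt0.
Unshelve. all: by end_near. Qed.

(** The points reachable from [a] by [e]-steps form a set that contains the
    [e]-ball around each point of its closure, hence a clopen set. *)
Lemma connected_chainable (R : realType) (X : metricType R) (e : R) (a b : X) :
  connected [set: X] -> 0 < e ->
  exists2 s : seq X, path (fun x y => mdist x y < e) a s & last a s = b.
Proof.
move=> conX e0; pose r x y := mdist (x : X) y < e.
pose B := [set y | exists2 s : seq X, path r a s & last a s = y].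
have rB x y : r x y -> B x -> B y.
  move=> rxy [s ps sx]; exists (rcons s y); last by rewrite last_rcons.
  by rewrite rcons_path ps sx.
suff BT : B = [set: X] by have : B b by rewrite BT.
apply: conX; first by exists a, [::].
- exists B; last by rewrite setTI.
  rewrite openE => x Bx; apply/nbhs_ballP; exists e => //= y.
  by rewrite ballEmdist => /= xy; apply: rB Bx.
- exists B; last by rewrite setTI.
  move=> x /(_ _ (nbhsx_ballx x e e0))[y [By]].
  by rewrite ballEmdist/= metric_sym => yx; apply: rB By.
Qed.

(** Following a chain [p] with small steps, each point being carried once
    around its orbit before moving on to the next, gives a pseudo-orbit: the
    only errors occur when a turn is completed, and they are steps of [p]. *)
Lemma periodic_pseudo_orbit (R : realType) (X : metricType R) (f : X -> X)
    (m : nat) (d : R) (p : nat -> X) :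
  (0 < m)%N -> iter m f =1 id -> 0 < d ->
  (forall j, mdist (p j) (p j.+1) < d) ->
  pseudo_orbit f d (fun i => iter (i %% m) f (p (i %/ m)%N)).
Proof.
move=> m0 fm d0 pd i; rewrite -iterS modnS divnS//.
have [mi|_] := ifP; last by rewrite mdistxx.
have -> : (i %% m).+1 = m.
  apply/eqP; rewrite eqn_leq ltn_pmod//= dvdn_leq//.
  by rewrite /dvdn -addn1 modnDml addn1.
by rewrite fm.
Qed.

Lemma periodic_not_shadowing (R : realType) (X : metricType R) (f : X -> X)
    (m : nat) :
  connected [set: X] -> (exists x y : X, x <> y) ->
  (0 < m)%N -> iter m f =1 id -> ~ shadowing f.
Proof.
move=> conX [a [b /eqP ab]] m0 fm shf.
have ab0 : 0 < mdist a b / 2 by rewrite divr_gt0// mdist_gt0.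
have [d d0 shd] := shf _ ab0.
have [s /(pathP b) sd sb] := connected_chainable a b conX d0.
(* The default value [b], the endpoint, prolongs the chain by a constant one. *)
pose p j := nth b (a :: s) j.
have pd j : mdist (p j) (p j.+1) < d.
  rewrite /p; have [/sd//|sj] := ltnP j (size s).
  rewrite [X in mdist _ X]nth_default//.
  have [js|sj'] := leqP j (size s); last by rewrite nth_default// mdistxx.
  have -> : j = size s by apply/eqP; rewrite eqn_leq js.
  by rewrite -[nth _ _ _]/(nth b (a :: s) (size (a :: s)).-1) nth_last/= sb mdistxx.
have [z zp] := shd _ (periodic_pseudo_orbit m0 fm d0 pd).
(* The times divisible by [m] see the whole chain, but only one point of the
   periodic orbit of [z]. *)
have {}zp j : mdist (p j) z < mdist a b / 2.
  have := zp (j * m)%N; rewrite modnMl mulnK//= mulnC.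
  suff -> : iter (m * j) f z = z by [].
  by elim: j => [|j IH]; rewrite ?muln0// mulnS iterD IH fm.
have := metric_triangle a z b; rewrite leNgt => /negP; apply.
rewrite [ltRHS]splitr ltrD//; first exact: zp 0.
have := zp (size s); rewrite metric_sym.
by rewrite -[p _]/(nth b (a :: s) (size (a :: s)).-1) nth_last/= sb.
Qed.

Lemma injective_finite_iter_periodic (T : Type) (f : T -> T)
    (A : set (T -> T)) :
  injective f -> finite_set A -> (forall k, A (iter k f)) ->
  exists2 m, (0 < m)%N & iter m f =1 id.
Proof.
move=> inj_f finA Af.
have /existsNP[i /existsNP[j /not_implyP[ijE /eqP ij]]] :
    ~ injective (fun k => iter k f).
  move=> inj; apply: infinite_nat.
  have fin : finite_set ((fun k => iter k f) @` [set: nat]).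
    by apply: sub_finite_set finA => _ [k _ <-].
  by rewrite -(eq_finite_set (inj_card_eq (in2W inj))).
wlog {ij} ij : i j ijE / (i < j)%N.
  move=> wl; move: ij; rewrite neq_ltn => /orP[]; first exact: wl.
  by apply: wl.
exists (j - i)%N; rewrite ?subn_gt0// => x.
have inj_i : injective (iter i f) by elim: (i) => //= k IH y z /inj_f/IH.
by apply: inj_i; rewrite -iterD subnKC 1?ltnW// ijE.
Qed.

Lemma csurjs_iter (X : topologicalType) (f : X -> X) (k : nat) :
  csurjs f -> csurjs (iter k f).
Proof.
move=> [cf sf]; elim: k => [|k [ck sk]]; first by split=> [x|x _]; [|exists x].
split=> [x|y _]; first by apply: continuous_comp; [exact: ck|exact: cf].
by have [x _ <-] := sf y I; have [z _ <-] := sk x I; exists z.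
Qed.

Lemma cook_surj_periodic (R : realType) (n : nat) (H : metricType R)
    (f : H -> H) :
  cook_continuum n H -> csurjs f ->
  exists2 m, (0 < m)%N & iter m f =1 id.
Proof.
move=> hH sf; have [_ [h [_ fK _]]] := cook_csurj_homeo hH sf.
apply: (injective_finite_iter_periodic (can_inj fK)
  (cook_finite_csurjs hH)) => k.
exact: csurjs_iter.
Qed.

Theorem theorem16 (R : realType) (n : nat) (hn : (0 < n)%N) (H : metricType R)
    (hH : cook_continuum n H) (f : H -> H) (hf : csurjs f) :
  CGPOTP f /\ ~ shadowing f.
Proof.
split.
  move=> e e0; have [d d0 fd] := cook_surj_isolated hH hf.
  by exists d => // g cg /(fd g cg) -> x; exists x => i; rewrite mdistxx.
have [m m0 fm] := cook_surj_periodic hH hf.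
have [_ conH] := cook_is_continuum hH.
exact: periodic_not_shadowing conH (cook_nondegenerate hH) m0 fm.
Qed.
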